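(* Let $\nu>0$, and let $f=f(x,t)\ge 0$, $x\in\mathbb{R}$, $t\ge 0$, be a sufficiently smooth time-dependent density with $\int_{-\infty}^\infty f(x,t)\,dx=1$ for all $t$ and with zero boundary conditions at $x=\pm\infty$. Define $$g(x,t)=\int_{-\infty}^\infty e^{-|z|/\nu} f(x-z,t)\,dz,\qquad h(x,t)=\int_{-\infty}^\infty z\,e^{-|z|/\nu} f(x-z,t)\,dz .$$ Then $g$ and $h$ satisfy the differential equations $$-g_{xx}+\frac{g}{\nu^2}=\frac{2}{\nu}f,\qquad -h_{xx}+\frac{h}{\nu^2}=-2g_x ,$$ and the differential-integral equation $$f_t(x,t)=\left(\frac{\int_{-\infty}^\infty e^{-|z|/\nu} f(x-z,t)\,z\,dz}{\int_{-\infty}^\infty e^{-|z|/\nu} f(x-z,t)\,dz}\;f(x,t)\right)_x$$ can equivalently be stated as the following system of differential equations, containing no integrals, for $f$, $g$, $h$: $$f_t=\left(\frac{h}{g}\,f\right)_x,\qquad -g_{xx}+\frac{g}{\nu^2}=\frac{2}{\nu}f,\qquad -h_{xx}+\frac{h}{\nu^2}=-2g_x .$$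
   Context: Subscripts $x$ and $t$ denote partial derivatives. The function $f(x,t)$ is the density of opinion holders on the real line (the opinion axis) at time $t$. The differential-integral equation is a fully continuous analogue of Hegselmann-Krause opinion dynamics with interaction function $\eta(z)=e^{-z/\nu}$, $z\ge 0$, where $\nu>0$ is a parameter. ''Sufficiently smooth'' means smooth enough for differentiating under the integral sign and integrating by parts. *)

(* Defs.v *)
From Stdlib Require Import Reals.
From Coquelicot Require Import Coquelicot.
Open Scope R_scope.

(* Functions of (x, t) have type R -> R -> R; only their values at times t >= 0
   are ever referred to. *)

Definition int_R (F : R -> R) : R :=
  RInt_gen F (Rbar_locally m_infty) (Rbar_locally p_infty).

Definition converges_on_R (F : R -> R) : Prop :=
  ex_RInt_gen F (Rbar_locally m_infty) (Rbar_locally p_infty).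

(* u_t(x,t) = l on the time half-line: the increments are restricted to times
   s >= 0, so this is the ordinary derivative for t > 0 and the right derivative
   at t = 0. *)
Definition is_derive_t (u : R -> R -> R) (x t l : R) : Prop :=
  filterlim (fun s => (u x s - u x t) / (s - t))
    (within (fun s => 0 <= s) (locally' t)) (locally l).

Definition d_x (u : R -> R -> R) (x t : R) : R := Derive (fun y => u y t) x.

Definition d_xx (u : R -> R -> R) (x t : R) : R := d_x (d_x u) x t.

(* Derive is total, so differentiability is always required separately. *)
Definition twice_derivable_x (u : R -> R -> R) : Prop :=
  forall x t, 0 <= t ->
    ex_derive (fun y => u y t) x /\ ex_derive (fun y => d_x u y t) x.

Definition zero_at_infinity (u : R -> R -> R) : Prop :=
  forall t, 0 <= t ->
    is_lim (fun x => u x t) m_infty 0 /\ is_lim (fun x => u x t) p_infty 0.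

(* C^1 in x and differentiable in t.  This is enough for both sides of the
   evolution equation to be meaningful: one x-derivative of f is all that
   differentiating under the integral sign and integrating by parts need, the
   second derivatives falling on the kernel. *)
Definition sufficiently_smooth (f : R -> R -> R) : Prop :=
  forall x t, 0 <= t ->
    ex_derive (fun y => f y t) x /\
    continuous (fun y => d_x f y t) x /\
    (exists l, is_derive_t f x t l).

Definition g_integrand (nu : R) (f : R -> R -> R) (x t z : R) : R :=
  exp (- (Rabs z / nu)) * f (x - z) t.

Definition h_integrand (nu : R) (f : R -> R -> R) (x t z : R) : R :=
  z * exp (- (Rabs z / nu)) * f (x - z) t.

Definition g_of (nu : R) (f : R -> R -> R) (x t : R) : R :=
  int_R (g_integrand nu f x t).

Definition h_of (nu : R) (f : R -> R -> R) (x t : R) : R :=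
  int_R (h_integrand nu f x t).

Definition g_equation (nu : R) (f g : R -> R -> R) : Prop :=
  twice_derivable_x g /\
  forall x t, 0 <= t -> - d_xx g x t + g x t / nu ^ 2 = 2 / nu * f x t.

Definition h_equation (nu : R) (g h : R -> R -> R) : Prop :=
  twice_derivable_x h /\
  forall x t, 0 <= t -> - d_xx h x t + h x t / nu ^ 2 = - 2 * d_x g x t.

Definition evolution_equation (f g h : R -> R -> R) : Prop :=
  forall x t, 0 <= t ->
    exists l, is_derive_t f x t l /\
              is_derive (fun y => h y t / g y t * f y t) x l.

Definition integral_equation (nu : R) (f : R -> R -> R) : Prop :=
  forall x t, 0 <= t ->
    exists l, is_derive_t f x t l /\
      is_derive (fun y =>
        int_R (fun z => exp (- (Rabs z / nu)) * f (y - z) t * z) /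
        int_R (fun z => exp (- (Rabs z / nu)) * f (y - z) t) * f y t) x l.

Definition differential_system (nu : R) (f g h : R -> R -> R) : Prop :=
  evolution_equation f g h /\ g_equation nu f g /\ h_equation nu g h.

(* Main.v *)
Require Import Defs.
From Stdlib Require Import Reals Lra FunctionalExtensionality.
From Coquelicot Require Import Coquelicot.
Open Scope R_scope.

(** Put [a = / nu] and fix a time.  The kernel [exp (- a |z|)] is a sum of two
    one-sided exponentials, and convolving [f] with one of them solves a linear
    first-order equation.  Let [U], [W], [V], [Z] be the solutions that vanish
    at both infinities of

      U' = f - a U,   W' = a W - f,   V' = U - a V,   Z' = a Z - W.

    Then [U] and [W] are the contributions of [z >= 0] and [z <= 0] to [g], and
    since [z exp (- a z)] is the one-sided exponential convolved with itself,
    [V] and [- Z] are the corresponding contributions to [h].  Hence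
    [g = U + W] and [h = V - Z], and the two second-order equations follow by
    differentiating these sums; no derivative is ever taken under an integral
    sign.  The solutions come first ([vanishing_first_order_solution], with its
    mirror image); the improper integrals are then evaluated from explicit
    primitives built out of them ([convolution_potentials]).

    Positivity of [g]: for [f >= 0] both [U] and [W] are nonnegative, so
    [|g'| = a |W - U| <= a g].  Such a [g] vanishes everywhere as soon as it
    vanishes at one point, and then [f = 0] by the equation for [g],
    contradicting the unit mass ([g_of_positive]).

    Equivalence: for the convolutions themselves the integral equation is the
    evolution equation up to the order of the factors in an integrand.  For
    unknown [G] and [H] with zero boundary conditions, [G - g] solves
    [D'' = a^2 D] and vanishes at both infinities, so it is zero; then the
    equations for [H] and [h] have the same right-hand side and [H = h] for the
    same reason ([screened_poisson_unique]). *)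

(** * Calculus on the line *)

(** Puts the value of a derivative in the eta-expanded form in which
    [auto_derive] leaves it. *)
Lemma Derive_eta (F : R -> R) (x l : R) :
  is_derive F x l -> Derive (fun y : R => F y) x = l.
Proof. exact (is_derive_unique F x l). Qed.

Lemma nondecreasing_of_derive_nonneg (F dF : R -> R) (u v : R) :
  u <= v ->
  (forall x, u <= x <= v -> is_derive F x (dF x)) ->
  (forall x, u <= x <= v -> 0 <= dF x) ->
  F u <= F v.
Proof.
intros Huv HF Hpos.
destruct (MVT_gen F u v dF) as [c [Hc E]].
- intros x Hx; rewrite Rmin_left, Rmax_right in Hx by lra. apply HF; lra.
- intros x Hx; rewrite Rmin_left, Rmax_right in Hx by lra.
  apply continuity_pt_filterlim, (ex_derive_continuous F).
  exists (dF x); apply HF; lra.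
- rewrite Rmin_left, Rmax_right in Hc by lra.
  assert (0 <= dF c * (v - u)) by (apply Rmult_le_pos; [apply Hpos|]; lra).
  lra.
Qed.

Lemma constant_of_derive_zero (F : R -> R) :
  (forall x, is_derive F x 0) -> forall x y, F x = F y.
Proof.
intros HF x y.
destruct (MVT_gen F x y (fun _ => 0)) as [c [_ E]]; [| |lra].
- intros; apply HF.
- intros z _; apply continuity_pt_filterlim, (ex_derive_continuous F).
  exists 0; apply HF.
Qed.

Lemma is_lim_unique_const (F : R -> R) (x l1 l2 : Rbar) :
  is_lim F x l1 -> is_lim F x l2 -> l1 = l2.
Proof.
intros H1 H2; rewrite <- (is_lim_unique _ _ _ H1).
exact (is_lim_unique _ _ _ H2).
Qed.

(** * Limits at infinity *)

Lemma is_lim_comp_scale_m (F : R -> R) (a : R) (l : Rbar) : 0 < a ->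
  is_lim F m_infty l -> is_lim (fun z => F (a * z)) m_infty l.
Proof.
intros Ha HF.
apply (is_lim_ext (fun z => F (a * z + 0))); [intros; f_equal; ring|].
apply (is_lim_comp_lin F a 0); [|lra].
replace (Rbar_plus (Rbar_mult a m_infty) 0) with m_infty; [exact HF|].
unfold Rbar_mult, Rbar_mult'; destruct (Rle_dec 0 a) as [h|h]; [|lra].
destruct (Rle_lt_or_eq_dec 0 a h); [reflexivity|lra].
Qed.

Lemma is_lim_scaled_exp_m (a : R) : 0 < a ->
  is_lim (fun z => exp (a * z)) m_infty 0.
Proof.
intros Ha; exact (is_lim_comp_scale_m exp a 0 Ha is_lim_exp_m).
Qed.

Lemma is_lim_scaled_id_exp_m (a : R) : 0 < a ->
  is_lim (fun z => z * exp (a * z)) m_infty 0.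
Proof.
intros Ha.
apply (is_lim_ext (fun z => / a * (a * z * exp (a * z)))); [intros; field; lra|].
replace (Finite 0) with (Rbar_mult (/ a) 0) by (simpl; f_equal; ring).
apply is_lim_scal_l.
exact (is_lim_comp_scale_m (fun u => u * exp u) a 0 Ha is_lim_mul_exp_m).
Qed.

Lemma is_lim_shifted_reflect_p (F : R -> R) (x : R) (l : Rbar) :
  is_lim F m_infty l -> is_lim (fun z => F (x - z)) p_infty l.
Proof.
intros H.
apply (is_lim_ext (fun z => F (-1 * z + x))); [intros; f_equal; ring|].
apply is_lim_comp_lin; [|lra].
replace (Rbar_plus (Rbar_mult (-1) p_infty) x) with m_infty; [exact H|].
unfold Rbar_mult, Rbar_mult'.
destruct (Rle_dec 0 (-1)); [exfalso; lra|reflexivity].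
Qed.

Lemma is_lim_shifted_reflect_m (F : R -> R) (x : R) (l : Rbar) :
  is_lim F p_infty l -> is_lim (fun z => F (x - z)) m_infty l.
Proof.
intros H.
apply (is_lim_ext (fun z => F (-1 * z + x))); [intros; f_equal; ring|].
apply is_lim_comp_lin; [|lra].
replace (Rbar_plus (Rbar_mult (-1) m_infty) x) with p_infty; [exact H|].
unfold Rbar_mult, Rbar_mult'.
destruct (Rle_dec 0 (-1)); [exfalso; lra|reflexivity].
Qed.

Lemma is_lim_reflect_p (F : R -> R) (l : Rbar) :
  is_lim F m_infty l -> is_lim (fun z => F (- z)) p_infty l.
Proof.
intros H; apply (is_lim_ext (fun z => F (0 - z))); [intros; f_equal; ring|].
now apply is_lim_shifted_reflect_p.
Qed.

Lemma is_lim_reflect_m (F : R -> R) (l : Rbar) :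
  is_lim F p_infty l -> is_lim (fun z => F (- z)) m_infty l.
Proof.
intros H; apply (is_lim_ext (fun z => F (0 - z))); [intros; f_equal; ring|].
now apply is_lim_shifted_reflect_m.
Qed.

Lemma is_lim_mult_zero (F G : R -> R) (p : Rbar) :
  is_lim F p 0 -> is_lim G p 0 -> is_lim (fun z => F z * G z) p 0.
Proof.
intros HF HG.
replace (Finite 0) with (Rbar_mult 0 0) by (simpl; f_equal; ring).
apply is_lim_mult; [exact HF|exact HG|exact I].
Qed.

Lemma is_lim_scal_zero (F : R -> R) (c : R) (p : Rbar) :
  is_lim F p 0 -> is_lim (fun z => c * F z) p 0.
Proof.
intros HF.
replace (Finite 0) with (Rbar_mult c 0) by (simpl; f_equal; ring).
now apply is_lim_scal_l.
Qed.

Lemma is_lim_plus_zero (F G : R -> R) (p : Rbar) :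
  is_lim F p 0 -> is_lim G p 0 -> is_lim (fun z => F z + G z) p 0.
Proof.
intros HF HG.
replace (Finite 0) with (Finite (0 + 0)) by (f_equal; ring).
apply is_lim_plus'; assumption.
Qed.

Lemma is_lim_minus_zero (F G : R -> R) (p : Rbar) :
  is_lim F p 0 -> is_lim G p 0 -> is_lim (fun z => F z - G z) p 0.
Proof.
intros HF HG.
replace (Finite 0) with (Finite (0 - 0)) by (f_equal; ring).
apply is_lim_minus'; assumption.
Qed.

(** * First-order equations with vanishing source *)

(** Where [|f| <= eps], the functions [eps / a * exp (a x) - P] and
    [eps / a * exp (a x) + P] are both nondecreasing. *)
Lemma exp_primitive_increment (a eps u v : R) (f P : R -> R) :
  0 < a -> u <= v ->
  (forall x, is_derive P x (exp (a * x) * f x)) ->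
  (forall x, u <= x <= v -> Rabs (f x) <= eps) ->
  Rabs (P v - P u) <= eps / a * (exp (a * v) - exp (a * u)).
Proof.
intros Ha Huv HP Hf.
assert (H1 : eps / a * exp (a * u) - P u <= eps / a * exp (a * v) - P v).
{ apply (nondecreasing_of_derive_nonneg
    (fun x => eps / a * exp (a * x) - P x)
    (fun x => exp (a * x) * (eps - f x))); [exact Huv| |].
  - intros x _; auto_derive; [eexists; apply HP|].
    rewrite (Derive_eta _ _ _ (HP x)); field; lra.
  - intros x Hx. apply Rmult_le_pos; [left; apply exp_pos|].
    generalize (Rle_abs (f x)) (Hf x Hx); lra. }
assert (H2 : eps / a * exp (a * u) + P u <= eps / a * exp (a * v) + P v).
{ apply (nondecreasing_of_derive_nonneg
    (fun x => eps / a * exp (a * x) + P x)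
    (fun x => exp (a * x) * (eps + f x))); [exact Huv| |].
  - intros x _; auto_derive; [eexists; apply HP|].
    rewrite (Derive_eta _ _ _ (HP x)); field; lra.
  - intros x Hx. apply Rmult_le_pos; [left; apply exp_pos|].
    generalize (Rle_abs (- f x)) (Hf x Hx); rewrite Rabs_Ropp; lra. }
apply Rabs_le; lra.
Qed.

(** The increments of [P] are controlled by those of [exp (a x)], which has a
    limit, so [P] is Cauchy at minus infinity. *)
Lemma exp_primitive_limit (a : R) (f P : R -> R) :
  0 < a ->
  (forall x, is_derive P x (exp (a * x) * f x)) ->
  is_lim f m_infty 0 ->
  exists L : R, is_lim P m_infty L.
Proof.
intros Ha HP Hf.
apply is_lim_spec in Hf.
destruct (Hf (mkposreal 1 Rlt_0_1)) as [N HN]; simpl in HN.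
assert (HE := is_lim_scaled_exp_m a Ha); apply is_lim_spec in HE.
apply (filterlim_locally_cauchy (F := Rbar_locally m_infty) P).
intros eps.
assert (Hd : 0 < a * eps) by (apply Rmult_lt_0_compat; [lra|apply cond_pos]).
destruct (HE (mkposreal _ Hd)) as [N' HN']; simpl in HN'.
exists (fun x => x < N /\ x < N').
split.
{ exists (Rmin N N'); intros x Hx; split; eapply Rlt_le_trans; try exact Hx;
  [apply Rmin_l|apply Rmin_r]. }
assert (key : forall u v, u < N /\ u < N' -> v < N /\ v < N' -> u <= v ->
  Rabs (P v - P u) < eps).
{ intros u v Hu Hv Huv.
  eapply Rle_lt_trans.
  - apply (exp_primitive_increment a 1 u v f P Ha Huv HP).
    intros x Hx. left. rewrite <- (Rminus_0_r (f x)). apply HN; lra.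
  - assert (h := HN' v (proj2 Hv)). rewrite Rminus_0_r in h.
    assert (h0 := exp_pos (a * u)).
    assert (h1 := Rle_abs (exp (a * v))).
    apply (Rmult_lt_reg_l a); [exact Ha|].
    replace (a * (1 / a * (exp (a * v) - exp (a * u))))
      with (exp (a * v) - exp (a * u)) by (field; lra).
    lra. }
intros u v Hu Hv.
change (Rabs (P v - P u) < eps).
destruct (Rle_dec u v) as [h|h]; [exact (key u v Hu Hv h)|].
rewrite Rabs_minus_sym; apply key; try assumption; lra.
Qed.

(** Variation of constants: [U x = exp (- a x) (P x - L)], where [P] is a
    primitive of [exp (a y) f y] and [L] its limit at minus infinity.  This is
    the integral of [exp (- a (x - y)) f y] over [y <= x], and the choice of
    [L] is what makes it bounded on the left. *)
Lemma vanishing_first_order_solution (a : R) (f : R -> R) :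
  0 < a ->
  (forall x, continuous f x) ->
  is_lim f m_infty 0 -> is_lim f p_infty 0 ->
  exists U : R -> R,
    (forall x, is_derive U x (f x - a * U x)) /\
    is_lim U m_infty 0 /\ is_lim U p_infty 0.
Proof.
intros Ha Cf fm fp.
set (k := fun y => exp (a * y) * f y).
assert (Ck : forall x, continuous k x).
{ intros x; apply (continuous_mult (fun y => exp (a * y)) f); [|apply Cf].
  apply (ex_derive_continuous (fun y => exp (a * y))); auto_derive; exact I. }
pose (P := fun x => RInt k 0 x).
assert (HP : forall x, is_derive P x (k x)).
{ intros x; apply (is_derive_RInt k P 0); [|apply Ck].
  apply filter_forall; intros b; apply (RInt_correct k).
  apply (ex_RInt_continuous k); intros; apply Ck. }
destruct (exp_primitive_limit a f P Ha HP fm) as [L HL].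
pose (U := fun x => exp (- (a * x)) * (P x - L)).
assert (Einv : forall x, exp (- (a * x)) * exp (a * x) = 1).
{ intros x; rewrite <- exp_plus, <- exp_0; f_equal; ring. }
exists U; split; [|split].
- intros x; unfold U; auto_derive; [eexists; apply HP|].
  rewrite (Derive_eta _ _ _ (HP x)); unfold k.
  transitivity ((exp (- (a * x)) * exp (a * x)) * f x
                 - a * (exp (- (a * x)) * (P x - L))); [ring|].
  rewrite Einv; ring.
- apply is_lim_spec in fm; apply is_lim_spec; intros eps.
  assert (Hd : 0 < a * eps / 2).
  { apply Rmult_lt_0_compat; [|lra].
    apply Rmult_lt_0_compat; [lra|apply cond_pos]. }
  destruct (fm (mkposreal _ Hd)) as [N HN]; simpl in HN.
  exists N; intros x Hx.
  (* The increment bound on [y, x], with y sent to minus infinity. *)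
  assert (HPL : Rabs (P x - L) <= eps / 2 * exp (a * x)).
  { apply le_epsilon; intros d Hd0.
    assert (HL' := HL); apply is_lim_spec in HL'.
    destruct (HL' (mkposreal _ Hd0)) as [M HM]; simpl in HM.
    set (y := Rmin x (M - 1)).
    assert (y <= x) by apply Rmin_l.
    assert (y < M) by (generalize (Rmin_r x (M - 1)); unfold y; lra).
    assert (h1 := HM y H0).
    assert (h2 : Rabs (P x - P y) <= a * eps / 2 / a * (exp (a * x) - exp (a * y))).
    { apply (exp_primitive_increment a _ y x f P Ha H HP).
      intros z Hz; left; rewrite <- (Rminus_0_r (f z)); apply HN; lra. }
    replace (a * eps / 2 / a) with (eps / 2) in h2 by (field; lra).
    replace (P x - L) with ((P x - P y) + (P y - L)) by ring.
    eapply Rle_trans; [apply Rabs_triang|].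
    assert (0 <= eps / 2 * exp (a * y)).
    { apply Rmult_le_pos; [generalize (cond_pos eps); lra|left; apply exp_pos]. }
    lra. }
  rewrite Rminus_0_r; unfold U.
  rewrite Rabs_mult, (Rabs_pos_eq (exp _)) by (left; apply exp_pos).
  apply Rle_lt_trans with (exp (- (a * x)) * (eps / 2 * exp (a * x))).
  + apply Rmult_le_compat_l; [left; apply exp_pos|exact HPL].
  + replace (exp (- (a * x)) * (eps / 2 * exp (a * x)))
      with (eps / 2 * (exp (- (a * x)) * exp (a * x))) by ring.
    rewrite Einv; generalize (cond_pos eps); lra.
- apply is_lim_spec in fp; apply is_lim_spec; intros eps.
  assert (Hd : 0 < a * eps / 2).
  { apply Rmult_lt_0_compat; [|lra].
    apply Rmult_lt_0_compat; [lra|apply cond_pos]. }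
  destruct (fp (mkposreal _ Hd)) as [N HN]; simpl in HN.
  (* Beyond N + 1 the source contributes at most eps / 2; what was accumulated
     before, c, is damped by exp (- a x).  The bound for the damping divides by
     c + 1 because c may be 0. *)
  set (c := Rabs (P (N + 1) - L)).
  assert (HE := is_lim_reflect_p _ _ (is_lim_scaled_exp_m a Ha)).
  apply is_lim_spec in HE.
  assert (Hd2 : 0 < eps / 2 / (c + 1)).
  { apply Rdiv_lt_0_compat; [generalize (cond_pos eps); lra|].
    generalize (Rabs_pos (P (N + 1) - L)); unfold c; lra. }
  destruct (HE (mkposreal _ Hd2)) as [M HM]; simpl in HM.
  exists (Rmax (N + 1) M); intros x Hx.
  assert (Hx1 : N + 1 < x) by (eapply Rle_lt_trans; [apply Rmax_l|exact Hx]).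
  assert (Hx2 : M < x) by (eapply Rle_lt_trans; [apply Rmax_r|exact Hx]).
  assert (h2 : Rabs (P x - P (N + 1))
               <= a * eps / 2 / a * (exp (a * x) - exp (a * (N + 1)))).
  { apply (exp_primitive_increment a _ (N + 1) x f P Ha); [lra|exact HP|].
    intros z Hz; left; rewrite <- (Rminus_0_r (f z)); apply HN; lra. }
  replace (a * eps / 2 / a) with (eps / 2) in h2 by (field; lra).
  assert (HPL : Rabs (P x - L) <= eps / 2 * exp (a * x) + c).
  { replace (P x - L) with ((P x - P (N + 1)) + (P (N + 1) - L)) by ring.
    eapply Rle_trans; [apply Rabs_triang|]; fold c.
    assert (0 <= eps / 2 * exp (a * (N + 1))).
    { apply Rmult_le_pos; [generalize (cond_pos eps); lra|left; apply exp_pos]. }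
    lra. }
  assert (h3 := HM x Hx2); rewrite Rminus_0_r, Rabs_pos_eq in h3
    by (left; apply exp_pos).
  replace (a * - x) with (- (a * x)) in h3 by ring.
  assert (c0 : 0 <= c) by apply Rabs_pos.
  rewrite Rminus_0_r; unfold U.
  rewrite Rabs_mult, (Rabs_pos_eq (exp _)) by (left; apply exp_pos).
  apply Rle_lt_trans with (exp (- (a * x)) * (eps / 2 * exp (a * x) + c)).
  + apply Rmult_le_compat_l; [left; apply exp_pos|exact HPL].
  + replace (exp (- (a * x)) * (eps / 2 * exp (a * x) + c))
      with (eps / 2 * (exp (- (a * x)) * exp (a * x)) + exp (- (a * x)) * c)
      by ring.
    rewrite Einv.
    assert (exp (- (a * x)) * c <= exp (- (a * x)) * (c + 1))
      by (apply Rmult_le_compat_l; [left; apply exp_pos|lra]).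
    assert (exp (- (a * x)) * (c + 1) < eps / 2).
    { replace (pos eps / 2) with (eps / 2 / (c + 1) * (c + 1)) by (field; lra).
      apply Rmult_lt_compat_r; lra. }
    lra.
Qed.

(** The reflection [x |-> - x] exchanges the two first-order equations. *)
Lemma vanishing_first_order_solution_left (a : R) (f : R -> R) :
  0 < a ->
  (forall x, continuous f x) ->
  is_lim f m_infty 0 -> is_lim f p_infty 0 ->
  exists W : R -> R,
    (forall x, is_derive W x (a * W x - f x)) /\
    is_lim W m_infty 0 /\ is_lim W p_infty 0.
Proof.
intros Ha Cf fm fp.
destruct (vanishing_first_order_solution a (fun x => f (- x)))
  as [U [HU [Um Up]]]; [exact Ha| |now apply is_lim_reflect_m
                        |now apply is_lim_reflect_p|].
{ intros x; apply (continuous_comp Ropp f); [|apply Cf].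
  apply (continuous_opp (fun y : R => y)), continuous_id. }
exists (fun x => U (- x)); split; [|split].
- intros x; auto_derive; [eexists; apply HU|].
  rewrite (Derive_eta _ _ _ (HU (- x))), Ropp_involutive; ring.
- now apply is_lim_reflect_m.
- now apply is_lim_reflect_p.
Qed.

(** [exp (a x) U x] is nondecreasing and starts from 0 at minus infinity. *)
Lemma first_order_solution_nonneg (a : R) (f U : R -> R) :
  0 < a ->
  (forall x, 0 <= f x) ->
  (forall x, is_derive U x (f x - a * U x)) ->
  is_lim U m_infty 0 ->
  forall x, 0 <= U x.
Proof.
intros Ha Hf HU Um x.
assert (H : Rbar_le 0 (exp (a * x) * U x)).
{ apply (is_lim_le_loc (fun y => exp (a * y) * U y)
          (fun _ => exp (a * x) * U x) m_infty); [| |apply is_lim_const].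
  - exists x; intros y Hy.
    apply (nondecreasing_of_derive_nonneg (fun y => exp (a * y) * U y)
             (fun y => exp (a * y) * f y)); [lra| |].
    + intros z _; auto_derive; [eexists; apply HU|].
      rewrite (Derive_eta _ _ _ (HU z)); ring.
    + intros z _; apply Rmult_le_pos; [left; apply exp_pos|apply Hf].
  - apply is_lim_mult_zero; [now apply is_lim_scaled_exp_m|exact Um]. }
simpl in H.
apply (Rmult_le_reg_l (exp (a * x))); [apply exp_pos|lra].
Qed.

Lemma first_order_solution_left_nonneg (a : R) (f W : R -> R) :
  0 < a ->
  (forall x, 0 <= f x) ->
  (forall x, is_derive W x (a * W x - f x)) ->
  is_lim W p_infty 0 ->
  forall x, 0 <= W x.
Proof.
intros Ha Hf HW Wp x.
rewrite <- (Ropp_involutive x).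
apply (first_order_solution_nonneg a (fun y => f (- y)) (fun y => W (- y)) Ha).
- intros; apply Hf.
- intros y; auto_derive; [eexists; apply HW|].
  rewrite (Derive_eta _ _ _ (HW (- y))); ring.
- now apply is_lim_reflect_m.
Qed.

(** * Uniqueness for the second-order equation *)

(** The equation factors: [exp (- a x) (D' + a D)] and [exp (a x) (D' - a D)]
    are constants [c] and [d], so that
    [2 a D x = c exp (a x) - d exp (- a x)].  Vanishing at plus infinity forces
    [c = 0], vanishing at minus infinity [d = 0]. *)
Lemma vanishing_second_order_solution_zero (a : R) (D D1 : R -> R) :
  0 < a ->
  (forall x, is_derive D x (D1 x)) ->
  (forall x, is_derive D1 x (a ^ 2 * D x)) ->
  is_lim D m_infty 0 -> is_lim D p_infty 0 ->
  forall x, D x = 0.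
Proof.
intros Ha HD HD1 Dm Dp x.
pose (E := fun y => exp (- (a * y)) * (D1 y + a * D y)).
pose (F := fun y => exp (a * y) * (D1 y - a * D y)).
assert (HE : forall y, E y = E 0).
{ intros y; apply constant_of_derive_zero; clear y; intros y; unfold E.
  auto_derive; [repeat split; eexists; [apply HD1|apply HD]|].
  rewrite (Derive_eta _ _ _ (HD y)), (Derive_eta _ _ _ (HD1 y)); ring. }
assert (HF : forall y, F y = F 0).
{ intros y; apply constant_of_derive_zero; clear y; intros y; unfold F.
  auto_derive; [repeat split; eexists; [apply HD1|apply HD]|].
  rewrite (Derive_eta _ _ _ (HD y)), (Derive_eta _ _ _ (HD1 y)); ring. }
assert (Hinv : forall y, exp (a * y) * exp (- (a * y)) = 1).
{ intros y; rewrite <- exp_plus, <- exp_0; f_equal; ring. }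
assert (Hm := is_lim_scaled_exp_m a Ha).
assert (Hp := is_lim_reflect_p _ _ Hm).
assert (E0 : Finite (E 0) = 0).
{ apply (is_lim_unique_const (fun _ => E 0) p_infty); [apply is_lim_const|].
  apply (is_lim_ext (fun y => F 0 * (exp (a * - y) * exp (a * - y))
                              + 2 * a * (exp (a * - y) * D y))).
  - intros y; rewrite <- (HF y), <- (HE y); unfold E, F.
    replace (a * - y) with (- (a * y)) by ring.
    transitivity ((exp (a * y) * exp (- (a * y))) *
      (exp (- (a * y)) * (D1 y - a * D y)) + 2 * a * (exp (- (a * y)) * D y));
      [ring|rewrite Hinv; ring].
  - apply is_lim_plus_zero; apply is_lim_scal_zero; apply is_lim_mult_zero;
      assumption. }
assert (F0 : Finite (F 0) = 0).
{ apply (is_lim_unique_const (fun _ => F 0) m_infty); [apply is_lim_const|].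
  apply (is_lim_ext (fun y => E 0 * (exp (a * y) * exp (a * y))
                              + (- (2 * a)) * (exp (a * y) * D y))).
  - intros y; rewrite <- (HF y), <- (HE y); unfold E, F.
    transitivity ((exp (a * y) * exp (- (a * y))) *
      (exp (a * y) * (D1 y + a * D y)) - 2 * a * (exp (a * y) * D y));
      [ring|rewrite Hinv; ring].
  - apply is_lim_plus_zero; apply is_lim_scal_zero; apply is_lim_mult_zero;
      assumption. }
injection E0 as E0; injection F0 as F0.
assert (e1 := HE x); assert (f1 := HF x); rewrite E0 in e1; rewrite F0 in f1.
unfold E in e1; unfold F in f1.
apply Rmult_integral in e1; apply Rmult_integral in f1.
assert (x1 := exp_pos (a * x)); assert (x2 := exp_pos (- (a * x))).
apply (Rmult_eq_reg_l a); [|lra].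
destruct e1 as [e1|e1], f1 as [f1|f1]; lra.
Qed.

(** * The two convolutions *)

(** An integral over the line from two primitives, one for each half-line; it
    serves integrands that depend on [|z|]. *)
Lemma is_RInt_gen_line (phi phim phip Pm Pp : R -> R) (lm lp : R) :
  (forall z, z <= 0 -> phi z = phim z) ->
  (forall z, 0 <= z -> phi z = phip z) ->
  (forall z, is_derive Pm z (phim z)) ->
  (forall z, is_derive Pp z (phip z)) ->
  (forall z, continuous phim z) ->
  (forall z, continuous phip z) ->
  is_lim Pm m_infty lm -> is_lim Pp p_infty lp ->
  is_RInt_gen phi (Rbar_locally m_infty) (Rbar_locally p_infty)
    ((Pm 0 - lm) + (lp - Pp 0)).
Proof.
intros Em Ep Dm Dp Cm Cp Lm Lp.
assert (Hlim : filterlim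
  (fun ab : R * R => (Pm 0 - Pm (fst ab)) + (Pp (snd ab) - Pp 0))
  (filter_prod (Rbar_locally m_infty) (Rbar_locally p_infty))
  (locally ((Pm 0 - lm) + (lp - Pp 0)))).
{ apply (filterlim_comp_2 (fun ab : R * R => Pm 0 - Pm (fst ab))
    (fun ab : R * R => Pp (snd ab) - Pp 0) Rplus
    (G := locally (Pm 0 - lm)) (H := locally (lp - Pp 0)));
    [| |apply (filterlim_plus (Pm 0 - lm) (lp - Pp 0))].
  - apply (filterlim_comp _ _ _ fst (fun z => Pm 0 - Pm z) _
             (Rbar_locally m_infty)); [apply filterlim_fst|].
    apply (is_lim_minus' (fun _ => Pm 0) Pm m_infty (Pm 0) lm);
      [apply is_lim_const|exact Lm].
  - apply (filterlim_comp _ _ _ snd (fun z => Pp z - Pp 0) _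
             (Rbar_locally p_infty)); [apply filterlim_snd|].
    apply (is_lim_minus' Pp (fun _ => Pp 0) p_infty lp (Pp 0));
      [exact Lp|apply is_lim_const]. }
intros Q HQ.
specialize (Hlim Q HQ); unfold filtermap in Hlim.
unfold filtermapi.
assert (Hsgn : filter_prod (Rbar_locally m_infty) (Rbar_locally p_infty)
                 (fun ab : R * R => fst ab < 0 /\ 0 < snd ab)).
{ apply (Filter_prod _ _ _ (fun x => x < 0) (fun y => 0 < y));
    [exists 0; auto|exists 0; auto|simpl; auto]. }
generalize (filter_and _ _ Hsgn Hlim); apply filter_imp.
intros [c d] [[Hc Hd] HQcd]; simpl in *.
exists (Pm 0 - Pm c + (Pp d - Pp 0)); split; [|exact HQcd].
apply (is_RInt_Chasles phi c 0 d).
- apply (is_RInt_ext phim).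
  + intros z; rewrite Rmin_left, Rmax_right by lra; intros Hz.
    symmetry; apply Em; lra.
  + apply (is_RInt_derive Pm phim); intros; [apply Dm|apply Cm].
- apply (is_RInt_ext phip).
  + intros z; rewrite Rmin_left, Rmax_right by lra; intros Hz.
    symmetry; apply Ep; lra.
  + apply (is_RInt_derive Pp phip); intros; [apply Dp|apply Cp].
Qed.

(** The last conclusion is what makes [g] positive for a nonnegative density;
    it is stated here because it is the only later use of the splitting
    [g = U + W]. *)
Lemma convolution_potentials (a : R) (f : R -> R) :
  0 < a ->
  (forall x, continuous f x) ->
  is_lim f m_infty 0 -> is_lim f p_infty 0 ->
  exists g g1 h h1 : R -> R,
    (forall x, is_RInt_gen (fun z => exp (- (Rabs z * a)) * f (x - z))
                 (Rbar_locally m_infty) (Rbar_locally p_infty) (g x)) /\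
    (forall x, is_RInt_gen (fun z => z * exp (- (Rabs z * a)) * f (x - z))
                 (Rbar_locally m_infty) (Rbar_locally p_infty) (h x)) /\
    (forall x, is_derive g x (g1 x)) /\
    (forall x, is_derive g1 x (a ^ 2 * g x - 2 * a * f x)) /\
    (forall x, is_derive h x (h1 x)) /\
    (forall x, is_derive h1 x (a ^ 2 * h x + 2 * g1 x)) /\
    (is_lim g m_infty 0 /\ is_lim g p_infty 0) /\
    (is_lim h m_infty 0 /\ is_lim h p_infty 0) /\
    ((forall x, 0 <= f x) -> forall x, Rabs (g1 x) <= a * g x).
Proof.
intros Ha Cf fm fp.
destruct (vanishing_first_order_solution a f) as [U [HU [Um Up]]]; auto.
destruct (vanishing_first_order_solution_left a f) as [W [HW [Wm Wp]]]; auto.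
assert (CU : forall x, continuous U x).
{ intros x; apply (ex_derive_continuous U); eexists; apply HU. }
assert (CW : forall x, continuous W x).
{ intros x; apply (ex_derive_continuous W); eexists; apply HW. }
destruct (vanishing_first_order_solution a U) as [V [HV [Vm Vp]]]; auto.
destruct (vanishing_first_order_solution_left a W) as [Z [HZ [Zm Zp]]]; auto.
assert (Em := is_lim_scaled_exp_m a Ha).
assert (Ep := is_lim_reflect_p _ _ Em).
assert (Im := is_lim_scaled_id_exp_m a Ha).
assert (Ip := is_lim_reflect_p _ _ Im).
assert (Cs : forall x z, continuous (fun z => f (x - z)) z).
{ intros x z; apply (continuous_comp (fun z => x - z) f); [|apply Cf].
  apply (ex_derive_continuous (fun z => x - z)); auto_derive; exact I. }
exists (fun x => U x + W x), (fun x => a * (W x - U x)),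
  (fun x => V x - Z x), (fun x => U x + W x - a * (V x + Z x)).
split; [|split; [|split; [|split; [|split; [|split; [|split; [|split]]]]]]].
(* By the first-order equations, exp (a z) W (x - z) has derivative
   exp (a z) f (x - z) in z, and - exp (- a z) U (x - z) has derivative
   exp (- a z) f (x - z). *)
- intros x.
  replace (U x + W x) with
    ((exp (a * 0) * W (x - 0) - 0)
     + (0 - - (exp (a * - 0) * U (x - 0))))
    by (rewrite Ropp_0, Rmult_0_r, exp_0, !Rminus_0_r; ring).
  apply (is_RInt_gen_line _
    (fun z => exp (a * z) * f (x - z)) (fun z => exp (a * - z) * f (x - z))
    (fun z => exp (a * z) * W (x - z))
    (fun z => - (exp (a * - z) * U (x - z)))).
  + intros z Hz; rewrite Rabs_left1 by exact Hz; f_equal; f_equal; ring.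
  + intros z Hz; rewrite Rabs_pos_eq by exact Hz; f_equal; f_equal; ring.
  + intros z; auto_derive; [eexists; apply HW|].
    rewrite (Derive_eta _ _ _ (HW (x + - z))); unfold Rminus; ring.
  + intros z; auto_derive; [eexists; apply HU|].
    rewrite (Derive_eta _ _ _ (HU (x + - z))); unfold Rminus; ring.
  + intros z; apply (continuous_mult (fun z => exp (a * z)) (fun z => f (x - z)));
      [|apply Cs].
    apply (ex_derive_continuous (fun z => exp (a * z))); auto_derive; exact I.
  + intros z; apply (continuous_mult (fun z => exp (a * - z)) (fun z => f (x - z)));
      [|apply Cs].
    apply (ex_derive_continuous (fun z => exp (a * - z))); auto_derive; exact I.
  + apply is_lim_mult_zero; [exact Em|now apply is_lim_shifted_reflect_m].
  + replace (Finite 0) with (Rbar_opp 0) by (simpl; f_equal; ring).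
    apply is_lim_opp, is_lim_mult_zero;
      [exact Ep|now apply is_lim_shifted_reflect_p].
(* The primitives for the first moment: the derivative of z exp (a z) W (x - z)
   has the additional term exp (a z) W (x - z), which is the derivative of
   exp (a z) Z (x - z); likewise on the right with U and V. *)
- intros x.
  replace (V x - Z x) with
    ((0 * exp (a * 0) * W (x - 0) - exp (a * 0) * Z (x - 0) - 0)
     + (0 - (- 0 * exp (a * - 0) * U (x - 0) - exp (a * - 0) * V (x - 0))))
    by (rewrite Ropp_0, Rmult_0_r, exp_0, !Rminus_0_r; ring).
  apply (is_RInt_gen_line _
    (fun z => z * exp (a * z) * f (x - z))
    (fun z => z * exp (a * - z) * f (x - z))
    (fun z => z * exp (a * z) * W (x - z) - exp (a * z) * Z (x - z))
    (fun z => - z * exp (a * - z) * U (x - z) - exp (a * - z) * V (x - z))).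
  + intros z Hz; rewrite Rabs_left1 by exact Hz; f_equal; f_equal; f_equal; ring.
  + intros z Hz; rewrite Rabs_pos_eq by exact Hz; f_equal; f_equal; f_equal; ring.
  + intros z; auto_derive; [repeat split; eexists; [apply HW|apply HZ]|].
    rewrite (Derive_eta _ _ _ (HW (x + - z))), (Derive_eta _ _ _ (HZ (x + - z))).
    unfold Rminus; ring.
  + intros z; auto_derive; [repeat split; eexists; [apply HU|apply HV]|].
    rewrite (Derive_eta _ _ _ (HU (x + - z))), (Derive_eta _ _ _ (HV (x + - z))).
    unfold Rminus; ring.
  + intros z; apply (continuous_mult (fun z => z * exp (a * z)) (fun z => f (x - z)));
      [|apply Cs].
    apply (ex_derive_continuous (fun z => z * exp (a * z))); auto_derive; exact I.
  + intros z; apply (continuous_mult (fun z => z * exp (a * - z)) (fun z => f (x - z)));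
      [|apply Cs].
    apply (ex_derive_continuous (fun z => z * exp (a * - z))); auto_derive; exact I.
  + apply is_lim_minus_zero; apply is_lim_mult_zero;
      first [assumption|now apply is_lim_shifted_reflect_m].
  + apply is_lim_minus_zero; apply is_lim_mult_zero;
      first [assumption|now apply is_lim_shifted_reflect_p].
- intros x; auto_derive; [repeat split; eexists; [apply HU|apply HW]|].
  rewrite (Derive_eta _ _ _ (HU x)), (Derive_eta _ _ _ (HW x)); ring.
- intros x; auto_derive; [repeat split; eexists; [apply HW|apply HU]|].
  rewrite (Derive_eta _ _ _ (HU x)), (Derive_eta _ _ _ (HW x)); ring.
- intros x; auto_derive; [repeat split; eexists; [apply HV|apply HZ]|].
  rewrite (Derive_eta _ _ _ (HV x)), (Derive_eta _ _ _ (HZ x)); ring.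
- intros x; auto_derive;
    [repeat split; eexists; [apply HU|apply HW|apply HV|apply HZ]|].
  rewrite (Derive_eta _ _ _ (HU x)), (Derive_eta _ _ _ (HW x)),
    (Derive_eta _ _ _ (HV x)), (Derive_eta _ _ _ (HZ x)); ring.
- split; apply is_lim_plus_zero; assumption.
- split; apply is_lim_minus_zero; assumption.
- intros Hf x.
  assert (0 <= U x) by now apply (first_order_solution_nonneg a f).
  assert (0 <= W x) by now apply (first_order_solution_left_nonneg a f).
  rewrite Rabs_mult, (Rabs_pos_eq a) by lra.
  apply Rmult_le_compat_l; [lra|apply Rabs_le; lra].
Qed.

(** [|g'| <= a g] makes [g] nonnegative, [exp (a x) g x] nondecreasing and
    [exp (- a x) g x] nonincreasing, so a zero of [g] spreads to both sides. *)
Lemma source_zero_of_potential_zero (a x0 : R) (f g g1 : R -> R) :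
  0 < a ->
  (forall x, is_derive g x (g1 x)) ->
  (forall x, is_derive g1 x (a ^ 2 * g x - 2 * a * f x)) ->
  (forall x, Rabs (g1 x) <= a * g x) ->
  g x0 = 0 -> forall x, f x = 0.
Proof.
intros Ha Hg Hg1 Hb H0.
assert (Hb' : forall x, - (a * g x) <= g1 x <= a * g x).
{ intros x; generalize (Rle_abs (g1 x)) (Rle_abs (- g1 x)) (Hb x).
  rewrite Rabs_Ropp; lra. }
assert (gpos : forall x, 0 <= g x).
{ intros x; apply (Rmult_le_reg_l a); [exact Ha|].
  generalize (Rabs_pos (g1 x)) (Hb x); lra. }
assert (gneg : forall x, g x <= 0).
{ intros x; destruct (Rle_dec x x0) as [hx|hx].
  - assert (h : exp (a * x) * g x <= exp (a * x0) * g x0).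
    { apply (nondecreasing_of_derive_nonneg (fun y => exp (a * y) * g y)
        (fun y => exp (a * y) * (g1 y + a * g y))); [exact hx| |].
      - intros y _; auto_derive; [eexists; apply Hg|].
        rewrite (Derive_eta _ _ _ (Hg y)); ring.
      - intros y _; apply Rmult_le_pos; [left; apply exp_pos|].
        generalize (Hb' y); lra. }
    rewrite H0, Rmult_0_r in h.
    apply (Rmult_le_reg_l (exp (a * x))); [apply exp_pos|lra].
  - assert (h : - (exp (- (a * x0)) * g x0) <= - (exp (- (a * x)) * g x)).
    { apply (nondecreasing_of_derive_nonneg (fun y => - (exp (- (a * y)) * g y))
        (fun y => exp (- (a * y)) * (a * g y - g1 y))); [lra| |].
      - intros y _; auto_derive; [eexists; apply Hg|].
        rewrite (Derive_eta _ _ _ (Hg y)); ring.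
      - intros y _; apply Rmult_le_pos; [left; apply exp_pos|].
        generalize (Hb' y); lra. }
    rewrite H0, Rmult_0_r in h.
    apply (Rmult_le_reg_l (exp (- (a * x)))); [apply exp_pos|lra]. }
assert (gz : forall x, g x = 0) by (intros x; apply Rle_antisym; auto).
assert (g1z : forall x, g1 x = 0).
{ intros x; generalize (Hb' x); rewrite gz; lra. }
intros x.
assert (e : Derive (fun y => g1 y) x = 0).
{ rewrite (Derive_ext _ (fun _ => 0)) by exact g1z; apply Derive_const. }
rewrite (Derive_eta _ _ _ (Hg1 x)), gz in e.
apply (Rmult_eq_reg_l (2 * a)); lra.
Qed.

Lemma is_RInt_gen_line_zero :
  is_RInt_gen (fun _ : R => 0) (Rbar_locally m_infty) (Rbar_locally p_infty) 0.
Proof.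
enough (H : is_RInt_gen (fun _ : R => 0)
  (Rbar_locally m_infty) (Rbar_locally p_infty) ((0 - 0) + (0 - 0))).
{ now replace ((0 - 0) + (0 - 0)) with 0 in H by ring. }
apply (is_RInt_gen_line (fun _ => 0) (fun _ => 0) (fun _ => 0)
         (fun _ => 0) (fun _ => 0)); auto.
- intros z; apply (is_derive_const (V := R_NormedModule)).
- intros z; apply (is_derive_const (V := R_NormedModule)).
- intros z; apply continuous_const.
- intros z; apply continuous_const.
- apply is_lim_const.
- apply is_lim_const.
Qed.

(** * Back to functions of space and time *)

(** [convolution_potentials] at a fixed time, with [a = / nu]. *)
Lemma kernel_potentials (nu : R) (f : R -> R -> R) (t : R) :
  0 < nu ->
  sufficiently_smooth f -> zero_at_infinity f -> 0 <= t ->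
  exists g1 h1 : R -> R,
    (forall x, converges_on_R (g_integrand nu f x t)) /\
    (forall x, converges_on_R (h_integrand nu f x t)) /\
    (forall x, is_derive (fun y => g_of nu f y t) x (g1 x)) /\
    (forall x, is_derive g1 x (g_of nu f x t / nu ^ 2 - 2 / nu * f x t)) /\
    (forall x, is_derive (fun y => h_of nu f y t) x (h1 x)) /\
    (forall x, is_derive h1 x (h_of nu f x t / nu ^ 2 + 2 * g1 x)) /\
    (is_lim (fun x => g_of nu f x t) m_infty 0 /\
     is_lim (fun x => g_of nu f x t) p_infty 0) /\
    (is_lim (fun x => h_of nu f x t) m_infty 0 /\
     is_lim (fun x => h_of nu f x t) p_infty 0) /\
    ((forall x, 0 <= f x t) -> forall x, Rabs (g1 x) <= / nu * g_of nu f x t).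
Proof.
intros Hnu Sf Zf Ht.
destruct (convolution_potentials (/ nu) (fun x => f x t))
  as (g & g1 & h & h1 & Ig & Ih & Dg & Dg1 & Dh & Dh1 & Lg & Lh & Hb).
- now apply Rinv_0_lt_compat.
- intros x; apply (ex_derive_continuous (fun y => f y t)).
  exact (proj1 (Sf x t Ht)).
- exact (proj1 (Zf t Ht)).
- exact (proj2 (Zf t Ht)).
- assert (Eg : forall x, g x = g_of nu f x t).
  { intros x; symmetry; exact (is_RInt_gen_unique _ _ (Ig x)). }
  assert (Eh : forall x, h x = h_of nu f x t).
  { intros x; symmetry; exact (is_RInt_gen_unique _ _ (Ih x)). }
  exists g1, h1.
  split; [|split; [|split; [|split; [|split; [|split; [|split; [|split]]]]]]].
  + intros x; exists (g x); exact (Ig x).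
  + intros x; exists (h x); exact (Ih x).
  + intros x; exact (is_derive_ext _ _ _ _ Eg (Dg x)).
  + intros x; rewrite <- Eg.
    replace (g x / nu ^ 2 - 2 / nu * f x t)
      with ((/ nu) ^ 2 * g x - 2 * / nu * f x t) by (field; lra).
    apply Dg1.
  + intros x; exact (is_derive_ext _ _ _ _ Eh (Dh x)).
  + intros x; rewrite <- Eh.
    replace (h x / nu ^ 2 + 2 * g1 x)
      with ((/ nu) ^ 2 * h x + 2 * g1 x) by (field; lra).
    apply Dh1.
  + split; eapply is_lim_ext; try exact Eg; apply Lg.
  + split; eapply is_lim_ext; try exact Eh; apply Lh.
  + intros Hf x; rewrite <- Eg; now apply Hb.
Qed.

Lemma kernel_equations (nu : R) (f : R -> R -> R) :
  0 < nu -> sufficiently_smooth f -> zero_at_infinity f ->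
  g_equation nu f (g_of nu f) /\ h_equation nu (g_of nu f) (h_of nu f).
Proof.
intros Hnu Sf Zf.
split; split; intros x t Ht;
  destruct (kernel_potentials nu f t Hnu Sf Zf Ht)
    as (g1 & h1 & _ & _ & Dg & Dg1 & Dh & Dh1 & _);
  assert (Eg : forall y, g1 y = d_x (g_of nu f) y t)
    by (intros y; symmetry; exact (is_derive_unique _ _ _ (Dg y)));
  assert (Eh : forall y, h1 y = d_x (h_of nu f) y t)
    by (intros y; symmetry; exact (is_derive_unique _ _ _ (Dh y)));
  assert (Dg2 := is_derive_ext _ _ _ _ Eg (Dg1 x));
  assert (Dh2 := is_derive_ext _ _ _ _ Eh (Dh1 x)).
- split; eexists; [apply Dg|exact Dg2].
- unfold d_xx; unfold d_x at 1.
  rewrite (Derive_eta _ _ _ Dg2); ring.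
- split; eexists; [apply Dh|exact Dh2].
- unfold d_xx; unfold d_x at 1.
  rewrite (Derive_eta _ _ _ Dh2), Eg; ring.
Qed.

Lemma kernel_zero_at_infinity (nu : R) (f : R -> R -> R) :
  0 < nu -> sufficiently_smooth f -> zero_at_infinity f ->
  zero_at_infinity (g_of nu f) /\ zero_at_infinity (h_of nu f).
Proof.
intros Hnu Sf Zf.
split; intros t Ht;
  destruct (kernel_potentials nu f t Hnu Sf Zf Ht)
    as (g1 & h1 & _ & _ & _ & _ & _ & _ & Lg & Lh & _); assumption.
Qed.

(** The unit mass excludes [f = 0], hence excludes a zero of [g]. *)
Lemma g_of_positive (nu : R) (f : R -> R -> R) (x t : R) :
  0 < nu -> sufficiently_smooth f -> zero_at_infinity f -> 0 <= t ->
  (forall y, 0 <= f y t) ->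
  is_RInt_gen (fun y => f y t) (Rbar_locally m_infty) (Rbar_locally p_infty) 1 ->
  0 < g_of nu f x t.
Proof.
intros Hnu Sf Zf Ht Hf Hmass.
destruct (kernel_potentials nu f t Hnu Sf Zf Ht)
  as (g1 & h1 & _ & _ & Dg & Dg1 & _ & _ & _ & _ & Hb).
specialize (Hb Hf).
assert (Ha := Rinv_0_lt_compat nu Hnu).
assert (H0 : 0 <= g_of nu f x t).
{ apply (Rmult_le_reg_l (/ nu)); [exact Ha|].
  generalize (Rabs_pos (g1 x)) (Hb x); lra. }
destruct H0 as [H0|H0]; [exact H0|exfalso].
assert (fz : forall y, f y t = 0).
{ apply (source_zero_of_potential_zero (/ nu) x (fun y => f y t)
           (fun y => g_of nu f y t) g1 Ha Dg); auto.
  intros y.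
  replace ((/ nu) ^ 2 * g_of nu f y t - 2 * / nu * f y t)
    with (g_of nu f y t / nu ^ 2 - 2 / nu * f y t) by (field; lra).
  apply Dg1. }
assert (Hz := is_RInt_gen_line_zero).
apply R1_neq_R0.
rewrite <- (is_RInt_gen_unique _ _ Hmass), <- (is_RInt_gen_unique _ _ Hz).
apply RInt_gen_ext_eq; [exact fz|eexists; exact Hmass].
Qed.

(** Applied with source [2 / nu * f] for [g] and [- 2 * g_x] for [h]. *)
Lemma screened_poisson_unique (nu : R) (S u v : R -> R -> R) :
  0 < nu ->
  twice_derivable_x u -> twice_derivable_x v ->
  zero_at_infinity u -> zero_at_infinity v ->
  (forall x t, 0 <= t -> - d_xx u x t + u x t / nu ^ 2 = S x t) ->
  (forall x t, 0 <= t -> - d_xx v x t + v x t / nu ^ 2 = S x t) ->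
  forall x t, 0 <= t -> u x t = v x t.
Proof.
intros Hnu Du Dv Zu Zv Eu Ev x t Ht.
apply Rminus_diag_uniq.
apply (vanishing_second_order_solution_zero (/ nu) (fun y => u y t - v y t)
         (fun y => d_x u y t - d_x v y t)).
- now apply Rinv_0_lt_compat.
- intros y.
  exact (is_derive_minus _ _ _ _ _ (Derive_correct _ _ (proj1 (Du y t Ht)))
                                   (Derive_correct _ _ (proj1 (Dv y t Ht)))).
- intros y.
  replace ((/ nu) ^ 2 * (u y t - v y t)) with (d_xx u y t - d_xx v y t).
  + exact (is_derive_minus _ _ _ _ _ (Derive_correct _ _ (proj2 (Du y t Ht)))
                                     (Derive_correct _ _ (proj2 (Dv y t Ht)))).
  + transitivity (u y t / nu ^ 2 - v y t / nu ^ 2); [|field; lra].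
    generalize (Eu y t Ht) (Ev y t Ht); lra.
- apply is_lim_minus_zero; [apply Zu|apply Zv]; exact Ht.
- apply is_lim_minus_zero; [apply Zu|apply Zv]; exact Ht.
Qed.

(** The integrand of [h_of] is the one in the numerator of the flux, with its
    factors in another order. *)
Lemma integral_equation_evolution (nu : R) (f : R -> R -> R) :
  integral_equation nu f <-> evolution_equation f (g_of nu f) (h_of nu f).
Proof.
assert (E : forall y t,
  int_R (fun z => exp (- (Rabs z / nu)) * f (y - z) t * z) = h_of nu f y t).
{ intros y t; unfold h_of; f_equal; apply functional_extensionality.
  intros z; unfold h_integrand; ring. }
split; intros H x t Ht; destruct (H x t Ht) as [l [Hl Hd]];
  exists l; split; try exact Hl; revert Hd; apply is_derive_ext;
  intros y; rewrite E; reflexivity.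
Qed.

(** * Functions that agree at nonnegative times

    [G] and [H] are compared with the convolutions only at times [t >= 0], so
    equations are transported along this equality rather than rewritten. *)

Lemma d_x_ext (u v : R -> R -> R) :
  (forall x t, 0 <= t -> u x t = v x t) ->
  forall x t, 0 <= t -> d_x u x t = d_x v x t.
Proof.
intros E x t Ht; apply Derive_ext; intros y; now apply E.
Qed.

Lemma twice_derivable_x_ext (u v : R -> R -> R) :
  (forall x t, 0 <= t -> u x t = v x t) ->
  twice_derivable_x u -> twice_derivable_x v.
Proof.
intros E Du x t Ht; destruct (Du x t Ht) as [D1 D2]; split.
- revert D1; apply ex_derive_ext; intros y; now apply E.
- revert D2; apply ex_derive_ext; intros y; now apply d_x_ext.
Qed.

Lemma zero_at_infinity_ext (u v : R -> R -> R) :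
  (forall x t, 0 <= t -> u x t = v x t) ->
  zero_at_infinity u -> zero_at_infinity v.
Proof.
intros E Zu t Ht; destruct (Zu t Ht) as [Lm Lp].
split; [revert Lm|revert Lp]; apply is_lim_ext; intros y; now apply E.
Qed.

Lemma evolution_equation_ext (f g h G H : R -> R -> R) :
  (forall x t, 0 <= t -> g x t = G x t) ->
  (forall x t, 0 <= t -> h x t = H x t) ->
  evolution_equation f g h -> evolution_equation f G H.
Proof.
intros Eg Eh Hev x t Ht; destruct (Hev x t Ht) as [l [Hl Hd]].
exists l; split; [exact Hl|].
revert Hd; apply is_derive_ext; intros y; rewrite Eg, Eh by exact Ht.
reflexivity.
Qed.

Lemma differential_system_ext (nu : R) (f g h G H : R -> R -> R) :
  (forall x t, 0 <= t -> g x t = G x t) ->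
  (forall x t, 0 <= t -> h x t = H x t) ->
  differential_system nu f g h -> differential_system nu f G H.
Proof.
intros Eg Eh (Hev & [Dg Hg] & [Dh Hh]).
assert (Eg2 := d_x_ext _ _ (d_x_ext _ _ Eg)).
assert (Eh2 := d_x_ext _ _ (d_x_ext _ _ Eh)).
split; [now apply (evolution_equation_ext f g h)|split; split].
- now apply (twice_derivable_x_ext g).
- intros x t Ht; rewrite <- Eg by exact Ht.
  unfold d_xx; rewrite <- Eg2 by exact Ht; now apply Hg.
- now apply (twice_derivable_x_ext h).
- intros x t Ht; rewrite <- Eh by exact Ht.
  unfold d_xx; rewrite <- Eh2, <- (d_x_ext _ _ Eg) by exact Ht; now apply Hh.
Qed.

(** * The equivalence *)

Theorem mainTheorem1 (nu : R) (f : R -> R -> R)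
  (hnu : 0 < nu)
  (hf_nonneg : forall x t, 0 <= t -> 0 <= f x t)
  (hf_smooth : sufficiently_smooth f)
  (hf_mass : forall t, 0 <= t ->
     is_RInt_gen (fun x => f x t) (Rbar_locally m_infty) (Rbar_locally p_infty) 1)
  (hf_zero : zero_at_infinity f) :
  (* the integrals g and h and the quotient h / g are well defined *)
  (forall x t, 0 <= t ->
     converges_on_R (g_integrand nu f x t) /\
     converges_on_R (h_integrand nu f x t) /\
     0 < g_of nu f x t) /\
  (* g and h satisfy the two differential equations *)
  g_equation nu f (g_of nu f) /\
  h_equation nu (g_of nu f) (h_of nu f) /\
  (* the integral equation is equivalent to the system, for these g and h ... *)
  (integral_equation nu f <->
     differential_system nu f (g_of nu f) (h_of nu f)) /\
  (* ... and for unknown G and H with zero boundary conditions, which the system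
     then forces to be g and h *)
  (forall G H : R -> R -> R,
     (zero_at_infinity G /\ zero_at_infinity H /\ differential_system nu f G H) <->
     (integral_equation nu f /\
      forall x t, 0 <= t -> G x t = g_of nu f x t /\ H x t = h_of nu f x t)).
Proof.
destruct (kernel_equations nu f hnu hf_smooth hf_zero) as [Hg Hh].
destruct (kernel_zero_at_infinity nu f hnu hf_smooth hf_zero) as [Zg Zh].
split; [|split; [exact Hg|split; [exact Hh|split]]].
- intros x t Ht.
  destruct (kernel_potentials nu f t hnu hf_smooth hf_zero Ht)
    as (g1 & h1 & Cg & Ch & _).
  split; [apply Cg|split; [apply Ch|]].
  apply g_of_positive; auto.
- rewrite integral_equation_evolution; unfold differential_system; tauto.
- intros G H; split.
  + intros (ZG & ZH & Hev & [DG HG] & [DH HH]).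
    assert (EG : forall x t, 0 <= t -> G x t = g_of nu f x t).
    { apply (screened_poisson_unique nu (fun x t => 2 / nu * f x t));
        auto; apply Hg. }
    assert (EH : forall x t, 0 <= t -> H x t = h_of nu f x t).
    { apply (screened_poisson_unique nu (fun x t => - 2 * d_x (g_of nu f) x t));
        auto; try apply Hh.
      intros x t Ht; rewrite <- (d_x_ext _ _ EG) by exact Ht; now apply HH. }
    split; [|auto].
    apply integral_equation_evolution.
    now apply (evolution_equation_ext f G H).
  + intros [Hint E].
    assert (EG : forall x t, 0 <= t -> g_of nu f x t = G x t)
      by (intros x t Ht; symmetry; now apply E).
    assert (EH : forall x t, 0 <= t -> h_of nu f x t = H x t)
      by (intros x t Ht; symmetry; now apply E).
    split; [now apply (zero_at_infinity_ext (g_of nu f))|].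
    split; [now apply (zero_at_infinity_ext (h_of nu f))|].
    apply (differential_system_ext nu f (g_of nu f) (h_of nu f) G H EG EH).
    exact (conj (proj1 (integral_equation_evolution nu f) Hint) (conj Hg Hh)).
Qed.
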